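(* Let $a,b$ be positive integers with $a\le b$. Every nonnegative integer can be written as $ax^2+by^2+3(z^2+zw+w^2)$ with $x,y,z,w\in\mathbb{Z}$ if and only if $a=1$ and $b=2$. *)

(* Defs.v *)
From Stdlib Require Import ZArith.
Open Scope Z_scope.

Definition form (a b x y z w : Z) : Z :=
  a * x ^ 2 + b * y ^ 2 + 3 * (z ^ 2 + z * w + w ^ 2).

Definition universal (a b : Z) : Prop :=
  forall n : Z, 0 <= n -> exists x y z w : Z, form a b x y z w = n.

(* Main.v *)
(** Necessity: the values 1 and 2 force [a = 1] and [b <= 2], and
    [x^2 + y^2 + 3 (z^2 + z w + w^2)] misses 6.

    Sufficiency rests on the ternary form [T = x^2 + (z^2 + z w + w^2)], which
    represents every positive [m = 1 mod 3].  A representation by [T] can be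
    moved by a reflection so that [z^2 + z w + w^2] becomes divisible by 3, hence
    [m = x^2 + 3 (z^2 + z w + w^2)]; subtracting a suitable [2 y^2] from [n]
    reduces every residue of [n] mod 3 to this case.

    Up to equivalence [T] is the only positive ternary form of its discriminant,
    so it is enough to find such a form with first coefficient [m].  This amounts
    to a [q] with [- q] a square mod [4 m] and [- 3 m] a square mod [q].  Let [chi]
    be the Jacobi symbol of [- 3 m], which is periodic mod [N = 12 m] by
    quadratic reciprocity, and let [A n] be the sum of [chi d] over the divisors [d]
    of [n].  If [A n > 0] then [n = q s^2] with [- 3 m] a square mod [q].  Some
    [n = 8 m - 1 mod N] has [A n > 0]: since [chi (8 m - 1) = 1], the hyperbola
    method bounds the difference of the sums of [A n / sqrt n] over [n = 1] and
    over [n = 8 m - 1] mod [N], while the first sum diverges because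
    [A (k^2) >= 1] for all [k].  This replaces Dirichlet's theorem on primes. *)

Require Import Defs.
From Stdlib Require Import ZArith Znumtheory Lia List.
Open Scope Z_scope.

(** * Reduction of positive ternary forms of half-discriminant 3 *)

Definition ternary (a b c d e f x y z : Z) : Z :=
  a * x ^ 2 + b * y ^ 2 + c * z ^ 2 + d * (y * z) + e * (x * z) + f * (x * y).

Definition represents (a b c d e f m : Z) : Prop :=
  exists x y z, ternary a b c d e f x y z = m.

(* Four times the determinant of the Gram matrix, an integer for integer-valued forms. *)
Definition half_disc (a b c d e f : Z) : Z :=
  4 * a * b * c + d * e * f - a * d ^ 2 - b * e ^ 2 - c * f ^ 2.

Definition hex (z w : Z) : Z := z ^ 2 + z * w + w ^ 2.

Lemma represents_shift_x (s t a b c d e f m : Z) :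
  represents a b c d e f m ->
  represents a (a * s ^ 2 + f * s + b) (a * t ^ 2 + e * t + c)
    (2 * a * s * t + e * s + f * t + d) (2 * a * t + e) (2 * a * s + f) m.
Proof.
intros (x & y & z & H); exists (x - s * y - t * z), y, z.
rewrite <- H; unfold ternary; ring.
Qed.

Lemma represents_shift_y (r a b c d e f m : Z) :
  represents a b c d e f m ->
  represents a b (b * r ^ 2 + d * r + c) (2 * b * r + d) (f * r + e) f m.
Proof.
intros (x & y & z & H); exists x, (y - r * z), z.
rewrite <- H; unfold ternary; ring.
Qed.

Lemma represents_swap_xy (a b c d e f m : Z) :
  represents a b c d e f m -> represents b a c e d f m.
Proof.
intros (x & y & z & H); exists y, x, z.
rewrite <- H; unfold ternary; ring.
Qed.

Lemma represents_swap_yz (a b c d e f m : Z) :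
  represents a b c d e f m -> represents a c b d f e m.
Proof.
intros (x & y & z & H); exists x, z, y.
rewrite <- H; unfold ternary; ring.
Qed.

Lemma centered_residue (u v : Z) : 0 < v -> exists r, - v <= u + 2 * v * r <= v.
Proof.
intros hv; exists (- ((u + v) / (2 * v))).
pose proof (Z.div_mod (u + v) (2 * v)); pose proof (Z.mod_pos_bound (u + v) (2 * v)).
nia.
Qed.

Lemma sqr_le_of_bounds (u v : Z) : - v <= u <= v -> u ^ 2 <= v * v.
Proof. intros h; nia. Qed.

(** With [A], [B], [C] as set in the proof, [4AC - B^2 = 16a * 3]. Reducedness gives
    [B^2 <= A^2 <= AC], so [A^2 <= 16a], while [a <= b] and [|f| <= a] give [A >= 3a^2]. Hence
    [a = 1], and finitely many coefficients are left. *)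
Lemma reduced_half_disc3 (a b c d e f m : Z) :
  0 < a -> 0 < 4 * a * b - f ^ 2 -> half_disc a b c d e f = 3 ->
  - a <= e <= a -> - a <= f <= a ->
  - (4 * a * b - f ^ 2) <= 4 * a * d - 2 * e * f <= 4 * a * b - f ^ 2 ->
  a <= b -> 4 * a * b - f ^ 2 <= 4 * a * c - e ^ 2 ->
  represents a b c d e f m -> exists x z w, m = x ^ 2 + hex z w.
Proof.
unfold half_disc; intros ha hA hD he hf hB hab hAC [x [y [z H]]].
set (A := 4 * a * b - f ^ 2) in *; set (B := 4 * a * d - 2 * e * f) in *.
set (C := 4 * a * c - e ^ 2) in *.
assert (hk : 4 * A * C - B ^ 2 = 48 * a).
{ unfold A, B, C. replace 48 with (16 * 3) by reflexivity. rewrite <- hD. ring. }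
pose proof (sqr_le_of_bounds _ _ hB) as hB2.
pose proof (sqr_le_of_bounds _ _ hf) as hff.
assert (hAA : A * A <= A * C) by (apply Z.mul_le_mono_nonneg_l; lia).
assert (hA2 : A * A <= 16 * a) by lia.
assert (h3 : 3 * (a * a) <= A) by (clear - ha hff hab; unfold A; nia).
assert (h0 : 0 <= 3 * (a * a)) by (pose proof (Z.square_nonneg a); lia).
assert (h9 : 3 * (a * a) * (3 * (a * a)) <= A * A) by (apply Z.mul_le_mono_nonneg; assumption).
assert (a = 1).
{ destruct (Z_lt_le_dec a 2) as [h | h]; [lia |].
  assert (h4 : 2 * 2 <= a * a) by (apply Z.mul_le_mono_nonneg; lia). clear - ha h h4 h9 hA2.
  assert (4 * (a * a) <= a * a * (a * a)) by nia. nia. }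
subst a.
assert (hA4 : A <= 4) by (clear - hA2; nia).
assert (hb : b = 1) by (clear - hA4 hff hab; unfold A in *; lia). subst b.
assert (hfe : f = 0 \/ f = 1 \/ f = -1) by lia.
assert (hee : e = 0 \/ e = 1 \/ e = -1) by lia.
assert (hdd : -1 <= d <= 1).
{ unfold B in hB. destruct hfe as [-> | [-> | ->]]; destruct hee as [-> | [-> | ->]]; lia. }
assert (hdd' : d = 0 \/ d = 1 \/ d = -1) by lia.
clear hk hA2 h3 h9 hB2 hAA hff hdd hA4.
(* The survivors are [x^2 + hex z w] up to the order and signs of the variables. *)
assert (hc : (c = 1 /\ e = 0) /\ ((f = 0 /\ (d = 1 \/ d = -1)) \/ (d = 0 /\ (f = 1 \/ f = -1)))).
{ unfold A, B, C in *. clear A B C H.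
  destruct hfe as [ -> | [ -> | -> ]]; destruct hee as [ -> | [ -> | -> ]];
  destruct hdd' as [ -> | [ -> | -> ]]; lia. }
destruct hc as [[-> ->] [[-> [-> | ->]] | [-> [-> | ->]]]]; unfold ternary in H; unfold hex.
- exists x, y, z; rewrite <- H; ring.
- exists x, y, (-z); rewrite <- H; ring.
- exists z, x, y; rewrite <- H; ring.
- exists z, x, (-y); rewrite <- H; ring.
Qed.

(* Lexicographic descent on the first coefficient and on the leading coefficient
   [4ab - f^2] of the binary form [4a g - (2ax + fy + ez)^2]. *)
Lemma half_disc3_represents (a b c d e f m : Z) :
  0 < a -> 0 < 4 * a * b - f ^ 2 -> half_disc a b c d e f = 3 ->
  represents a b c d e f m -> exists x z w, m = x ^ 2 + hex z w.
Proof.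
intros ha; revert b c d e f.
induction a as [a IHa] using (well_founded_induction (Z.lt_wf 0)).
intros b c d e f; remember (4 * a * b - f ^ 2) as A eqn:HA; revert b c d e f HA.
induction A as [A IHA] using (well_founded_induction (Z.lt_wf 0)).
intros b c d e f HA hA hD hm.
destruct (centered_residue (4 * a * d - 2 * e * f) A hA) as [r hr].
apply (represents_shift_y r) in hm.
set (c1 := b * r ^ 2 + d * r + c) in *; set (d1 := 2 * b * r + d) in *.
set (e1 := f * r + e) in *.
destruct (centered_residue f a ha) as [s hs].
destruct (centered_residue e1 a ha) as [t ht].
(* [A] and [4ad - 2ef] are coefficients of the binary form left after completing the square in [x].
   Shifting [x] changes neither, so the reduction by [r] survives. *)
apply (represents_shift_x s t) in hm.
set (b2 := a * s ^ 2 + f * s + b) in *; set (c2 := a * t ^ 2 + e1 * t + c1) in *.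
set (d2 := 2 * a * s * t + e1 * s + f * t + d1) in *.
set (e2 := 2 * a * t + e1) in *; set (f2 := 2 * a * s + f) in *.
assert (HA2 : A = 4 * a * b2 - f2 ^ 2) by (rewrite HA; unfold b2, f2; ring).
assert (hD2 : half_disc a b2 c2 d2 e2 f2 = 3).
{ rewrite <- hD; unfold half_disc, b2, c2, d2, e2, f2, c1, d1, e1; ring. }
assert (hB2 : 4 * a * d2 - 2 * e2 * f2 = 4 * a * d - 2 * e * f + 2 * A * r).
{ rewrite HA; unfold d2, e2, f2, d1, e1; ring. }
assert (hC2 : 4 * A * (4 * a * c2 - e2 ^ 2) - (4 * a * d2 - 2 * e2 * f2) ^ 2 = 48 * a).
{ rewrite HA2; replace 48 with (16 * 3) by reflexivity; rewrite <- hD2.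
  unfold half_disc; ring. }
assert (he2 : - a <= e2 <= a) by (unfold e2; lia).
assert (hf2 : - a <= f2 <= a) by (unfold f2; lia).
clearbody b2 c2 d2 e2 f2.
destruct (Z_lt_le_dec b2 a) as [hba | hba].
- assert (0 < b2) by (clear - ha hA HA2; nia).
  apply (IHa b2) with (b := a) (c := c2) (d := e2) (e := d2) (f := f2); try lia.
  + rewrite <- hD2; unfold half_disc; ring.
  + apply represents_swap_xy; exact hm.
- destruct (Z_lt_le_dec (4 * a * c2 - e2 ^ 2) A) as [hCA | hCA].
  + assert (0 < 4 * a * c2 - e2 ^ 2) by (revert hC2;
      generalize (4 * a * c2 - e2 ^ 2) (4 * a * d2 - 2 * e2 * f2); clear - hA ha; intros; nia).
    apply (IHA (4 * a * c2 - e2 ^ 2)) with (b := c2) (c := b2) (d := d2) (e := f2) (f := e2);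
      try lia.
    * rewrite <- hD2; unfold half_disc; ring.
    * apply represents_swap_yz; exact hm.
  + apply (reduced_half_disc3 a b2 c2 d2 e2 f2); rewrite <- ?HA2, ?hB2; assumption.
Qed.

(* With [k = - B / l] mod [4m], the form built here satisfies
   [4m g = (2m x + l y + k z)^2 + q y^2 + 2B y z + c z^2]. *)
Lemma represented_of_congruences (m q l B c : Z) :
  0 < m -> 0 < q -> q * c = B ^ 2 + 12 * m -> (4 * m | l ^ 2 + q) -> rel_prime l (4 * m) ->
  exists x z w, m = x ^ 2 + hex z w.
Proof.
intros hm hq hqc [b hb] hl.
destruct (rel_prime_bezout _ _ hl) as [u v huv].
assert (hd : exists d, l * (- B * u) + B = d * (4 * m)).
{ exists (B * v). transitivity (B * (1 - u * l)); [ring |]. rewrite <- huv. ring. }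
(* With [k = - B u], modulo [4m]: [l^2 (k^2 + c) = B^2 - q c = - 12m = 0], and [l] is invertible. *)
assert (hc : (4 * m | (- B * u) ^ 2 + c)).
{ apply (Gauss _ l); [| apply rel_prime_sym; exact hl].
  apply (Gauss _ l); [| apply rel_prime_sym; exact hl].
  destruct hd as [d hd].
  exists (d * (l * (- B * u) - B) + b * c - 3).
  transitivity ((l * (- B * u) + B) * (l * (- B * u) - B) + B ^ 2 + l ^ 2 * c); [ring |].
  replace (B ^ 2) with (q * c - 12 * m) by lia.
  replace (l ^ 2) with (b * (4 * m) - q) by lia.
  rewrite hd; ring. }
destruct hd as [d hd]; destruct hc as [c' hc]; set (k := - B * u) in *; clearbody k.
apply (half_disc3_represents m b c' (2 * d) k l); [lia | lia | |].
- apply (Z.mul_reg_l _ _ (4 * m)); [lia |].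
  unfold half_disc.
  transitivity ((b * (4 * m)) * (c' * (4 * m)) + 2 * (d * (4 * m)) * (k * l)
    - (d * (4 * m)) ^ 2 - (b * (4 * m)) * k ^ 2 - (c' * (4 * m)) * l ^ 2); [ring |].
  rewrite <- hb, <- hc, <- hd.
  transitivity (q * c - B ^ 2); [ring | lia].
- exists 1, 0, 0; unfold ternary; ring.
Qed.

(** * From [x^2 + hex] to [x^2 + 3 hex] *)

Lemma hex_mod3 (z w : Z) : (z - w) ^ 2 = hex z w + 3 * (- (z * w)).
Proof. unfold hex; ring. Qed.

Lemma sqr_mod3 (x : Z) : x mod 3 = 0 \/ x ^ 2 mod 3 = 1.
Proof.
assert (h : x mod 3 = 0 \/ x mod 3 = 1 \/ x mod 3 = 2) by (pose proof (Z.mod_pos_bound x 3); lia).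
rewrite Z.pow_2_r, Z.mul_mod by lia.
destruct h as [-> | [-> | ->]]; auto.
Qed.

(** As [x^2] is 1 mod 3, 3 divides [hex z w], which is [(z - w)^2] mod 3. Then [z = w + 3k], and
    [hex (w + 3k) w = 3 hex (w + k) k]. *)
Lemma represented_hex3_of_coprime (m x z w : Z) :
  m mod 3 = 1 -> x mod 3 <> 0 -> m = x ^ 2 + hex z w ->
  exists x' z' w', m = x' ^ 2 + 3 * hex z' w'.
Proof.
intros hm hx h.
destruct (sqr_mod3 x) as [h0 | h1]; [contradiction |].
pose proof (hex_mod3 z w) as hzw.
destruct (sqr_mod3 (z - w)) as [h2 | h2]; [| exfalso].
- pose proof (Z.div_mod (z - w) 3) as hk; set (k := (z - w) / 3) in *; clearbody k.
  exists x, (w + k), k; rewrite h; replace z with (w + 3 * k) by lia; unfold hex; ring.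
- pose proof (Z.div_mod m 3); pose proof (Z.div_mod (x ^ 2) 3).
  pose proof (Z.div_mod ((z - w) ^ 2) 3). lia.
Qed.

(* The new representation is the image of the old one under the reflection in the
   vector [(1, 1, 0)] of norm 2, which is integral here because [2 * w] is even. *)
Lemma represented_hex3_of_even (m x z w : Z) :
  m mod 3 = 1 -> x mod 3 = 0 -> m = x ^ 2 + hex z (2 * w) ->
  exists x' z' w', m = x' ^ 2 + 3 * hex z' w'.
Proof.
intros hm hx h.
apply (represented_hex3_of_coprime m (z + w) (- x - w) (2 * w) hm); [| rewrite h; unfold hex; ring].
(* If 3 divided both [x] and the new first coordinate [z + w], it would divide [m]. *)
intros hzw.
pose proof (Z.div_mod x 3) as h1; pose proof (Z.div_mod (z + w) 3) as h2.
set (i := x / 3) in *; set (j := (z + w) / 3) in *; clearbody i j.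
assert (hx3 : x = 3 * i) by lia; assert (hz3 : z = 3 * j - w) by lia.
assert (h3 : m = 3 * (3 * i ^ 2 + 3 * j ^ 2 + w ^ 2)) by (rewrite h, hx3, hz3; unfold hex; ring).
rewrite h3, Z.mul_comm, Z.mod_mul in hm; lia.
Qed.

(** One of [z], [w], [z + w] is even, and a symmetry of [hex] moves it to the second place. *)
Lemma represented_hex3 (m x z w : Z) :
  m mod 3 = 1 -> m = x ^ 2 + hex z w -> exists x' z' w', m = x' ^ 2 + 3 * hex z' w'.
Proof.
intros hm h.
destruct (Z.eq_dec (x mod 3) 0) as [hx | hx];
  [| exact (represented_hex3_of_coprime m x z w hm hx h)].
destruct (Zeven_odd_dec w) as [hw | hw].
{ destruct (Zeven_ex _ hw) as [w' ->]; exact (represented_hex3_of_even m x z w' hm hx h). }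
destruct (Zeven_odd_dec z) as [hz | hz].
- destruct (Zeven_ex _ hz) as [z' ->].
  apply (represented_hex3_of_even m x w z' hm hx); rewrite h; unfold hex; ring.
- destruct (Zodd_ex _ hw) as [w' ->]; destruct (Zodd_ex _ hz) as [z' ->].
  apply (represented_hex3_of_even m x (- (2 * w' + 1)) (z' + w' + 1) hm hx).
  rewrite h; unfold hex; ring.
Qed.

(** * Universality of the form with coefficients 1 and 2 *)

Definition iota_Z (n : nat) : list Z := map Z.of_nat (seq 0 n).

Definition form12_check (n : Z) : bool :=
  existsb (fun x => existsb (fun y => existsb (fun z => existsb (fun w =>
    form 1 2 x y z w =? n) (iota_Z 11)) (iota_Z 11)) (iota_Z 5)) (iota_Z 7).

Lemma form12_small (n : Z) :
  0 <= n < 338 -> n mod 3 = 2 -> exists x y z w, form 1 2 x y z w = n.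
Proof.
intros hn hr.
assert (hall : forallb (fun i => form12_check (3 * i + 2)) (iota_Z 112) = true)
  by (vm_compute; reflexivity).
rewrite forallb_forall in hall.
pose proof (Z.div_mod n 3) as hd; set (i := n / 3) in *; clearbody i.
assert (hin : In i (iota_Z 112)).
{ apply in_map_iff; exists (Z.to_nat i); split; [lia | apply in_seq; lia]. }
apply hall in hin; unfold form12_check in hin.
repeat (apply existsb_exists in hin; destruct hin as [? [_ hin]]).
apply Z.eqb_eq in hin; replace n with (3 * i + 2) by lia; eauto.
Qed.

(** For [n] equal to 1 or 0 mod 3, [y = 0] or [y = 1] makes [n - 2y^2] equal to 1 mod 3. For
    [n = 2 mod 3] no [y] does; instead [y] is chosen with [n - 2y^2 = 9 (3k + 1)]. *)
Lemma form12_universal :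
  (forall m, 0 < m -> m mod 3 = 1 -> exists x z w, m = x ^ 2 + hex z w) -> universal 1 2.
Proof.
intros core n hn.
assert (core3 : forall m, 0 < m -> m mod 3 = 1 -> exists x z w, m = x ^ 2 + 3 * hex z w).
{ intros m h0 h1; destruct (core m h0 h1) as (x & z & w & h).
  exact (represented_hex3 m x z w h1 h). }
assert (hr : n mod 3 = 1 \/ n mod 3 = 0 \/ n mod 3 = 2) by (pose proof (Z.mod_pos_bound n 3); lia).
destruct (Z.eq_dec n 0) as [hn0 | hn0]; [rewrite hn0; exists 0, 0, 0, 0; reflexivity |].
pose proof (Z.div_mod n 3) as hd3.
destruct hr as [h | [h | h]].
- destruct (core3 n) as (x & z & w & e); [lia | exact h |].
  exists x, 0, z, w; rewrite e; unfold form, hex; ring.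
- destruct (core3 (n - 2)) as (x & z & w & e).
  + lia.
  + rewrite Zminus_mod, h; reflexivity.
  + exists x, 1, z, w; transitivity (n - 2 + 2); [rewrite e; unfold form, hex; ring | ring].
(* [338 = 2 * 13^2], where 13 bounds the square roots mod 27 used below; so [n - 2y^2] is not
   negative. *)
- destruct (Z_lt_le_dec n 338) as [hlt | hge]; [apply form12_small; [lia | exact h] |].
  (* [(n - 9) / 2] is 1 mod 3, hence a square mod 27. *)
  assert (hy : exists y k, 0 <= y <= 13 /\ n = 2 * y ^ 2 + 9 * (3 * k + 1)).
  { pose proof (Z.div_mod n 27) as hd; pose proof (Z.mod_pos_bound n 27) as hb.
    pose proof (Z.div_mod n 3) as h3.
    set (k := n / 27) in *; set (r := n mod 27) in *; set (i := n / 3) in *.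
    clearbody k r i.
    assert (hr : r = 2 \/ r = 5 \/ r = 8 \/ r = 11 \/ r = 14 \/ r = 17 \/ r = 20 \/ r = 23
                 \/ r = 26) by lia.
    assert (aux : forall y j, 0 <= y <= 13 -> r = 2 * y ^ 2 + 9 + 27 * j ->
      exists y k, 0 <= y <= 13 /\ n = 2 * y ^ 2 + 9 * (3 * k + 1)).
    { intros y j ? ?; exists y, (k + j); lia. }
    destruct hr as [-> | [-> | [-> | [-> | [-> | [-> | [-> | [-> | ->]]]]]]]].
    - apply (aux 8 (-5)); lia.
    - apply (aux 5 (-2)); lia.
    - apply (aux 11 (-9)); lia.
    - apply (aux 1 (0)); lia.
    - apply (aux 4 (-1)); lia.
    - apply (aux 2 (0)); lia.
    - apply (aux 10 (-7)); lia.
    - apply (aux 13 (-12)); lia.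
    - apply (aux 7 (-3)); lia.
    }
  destruct hy as (y & k & hy & e).
  destruct (core (3 * k + 1)) as (x & z & w & e').
  + nia.
  + rewrite Z.add_comm, Z.mul_comm, Z_mod_plus_full; reflexivity.
  (* The factor 9 is absorbed by [9x^2 = (3x)^2] and [3 hex z w = hex (z - w) (z + 2w)]. *)
  + exists (3 * x), y, (z - w), (z + 2 * w); rewrite e, e'; unfold form, hex; ring.
Qed.

(** * Necessity of the coefficients *)

Lemma universal_coefficients (a b : Z) :
  0 < a -> 0 < b -> a <= b -> universal a b -> a = 1 /\ b = 2.
Proof.
intros ha hb hab h.
assert (hsq : forall t, t ^ 2 = 0 \/ t ^ 2 = 1 \/ t ^ 2 = 4 \/ 9 <= t ^ 2).
{ intros t; assert (t = 0 \/ t = 1 \/ t = -1 \/ t = 2 \/ t = -2 \/ 3 <= t \/ t <= -3) as ht by lia.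
  destruct ht as [-> | [-> | [-> | [-> | [-> | ht]]]]]; try lia; nia. }
(* Excluding the value 2 settles [x^2 + y^2 + 3 hex z w = 6]: the values 0 and 1 of [hex] would make
   6 or 3 a sum of two squares. *)
assert (hhex : forall z w, 0 <= hex z w /\ hex z w <> 2).
{ intros z w.
  assert (e : 4 * hex z w = (2 * z + w) ^ 2 + 3 * w ^ 2) by (unfold hex; ring).
  pose proof (hsq (2 * z + w)); pose proof (hsq w); lia. }
unfold universal, form in h.
assert (ha1 : a = 1).
{ destruct (h 1) as (x & y & z & w & e); [lia |].
  change (z ^ 2 + z * w + w ^ 2) with (hex z w) in e; pose proof (hhex z w).
  destruct (hsq x) as [hx | hx], (hsq y) as [hy | hy]; nia. }
subst a.
destruct (h 2) as (x & y & z & w & e); [lia |].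
change (z ^ 2 + z * w + w ^ 2) with (hex z w) in e; pose proof (hhex z w).
assert (hb2 : b <= 2) by (pose proof (hsq x); destruct (hsq y) as [hy | hy]; nia).
split; [reflexivity |].
assert (hb1 : b <> 1); [| lia].
intros ->; destruct (h 6) as (x' & y' & z' & w' & e'); [lia |].
change (z' ^ 2 + z' * w' + w' ^ 2) with (hex z' w') in e'; pose proof (hhex z' w').
pose proof (hsq x'); pose proof (hsq y'); lia.
Qed.

From mathcomp Require Import all_boot all_order all_algebra.
From mathcomp Require Import zify ring lra.
From mathcomp Require Import realalg.
Set Implicit Arguments.
Unset Strict Implicit.
Unset Printing Implicit Defensive.
Import Order.TTheory GRing.Theory Num.Theory.

Local Open Scope nat_scope.

(** * A Jacobi symbol with periodicity built in *)

(* The representative of [n * i] in [{1, ..., K-1}] modulo [2K] and up to sign. *)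
Definition fold_residue (K n i : nat) : nat :=
  let r := (n * i) %% (2 * K) in if r < K then r else 2 * K - r.

(** The parity of the number of [i] for which [n * i] falls in the upper half of the residues mod
    [4K]. *)
Definition floor_parity (K n : nat) : bool :=
  \big[addb/false]_(1 <= i < K) odd ((n * i) %/ (2 * K)).

(* The Jacobi symbol of [- K] over [n].  It is the Gauss-type sign of multiplication
   by [n] on residues mod [4K], which makes multiplicativity and periodicity in [n]
   evident; reciprocity is what relates it to squares, in [kron_prime]. *)
Definition kron (K n : nat) : int :=
  if coprime n (2 * K) then ((-1) ^+ (floor_parity K n (+) (odd K && odd n./2)))%R else 0%R.

Lemma perm_index_iota (f : nat -> nat) (m n : nat) :
  {in index_iota m n, forall i, f i \in index_iota m n} ->
  {in index_iota m n &, injective f} ->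
  perm_eq [seq f i | i <- index_iota m n] (index_iota m n).
Proof.
move=> fsub finj; have fu : uniq [seq f i | i <- index_iota m n].
  by rewrite map_inj_in_uniq ?iota_uniq.
apply: uniq_perm => //; first exact: iota_uniq.
have sub : {subset [seq f i | i <- index_iota m n] <= index_iota m n}.
  by move=> _ /mapP[i hi ->]; exact: fsub.
by case: (uniq_min_size fu sub _) => //; rewrite size_map.
Qed.

Lemma divn_unique (x d q : nat) : q * d <= x < q.+1 * d -> x %/ d = q.
Proof.
case/andP=> h1 h2; have d0 : 0 < d by case: d h2 {h1} => //; rewrite muln0.
by apply/eqP; rewrite eqn_leq -ltnS ltn_divLR // h2 leq_divRL.
Qed.

Lemma coprime_residue (K n i : nat) : coprime n (2 * K) -> 0 < i < K ->
  (0 < (n * i) %% (2 * K)) && ((n * i) %% (2 * K) != K).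
Proof.
move=> hn /andP[i0 iK]; apply/andP; split.
  rewrite lt0n; apply/negP => /eqP h.
  have : 2 * K %| n * i by rewrite /dvdn h.
  by rewrite Gauss_dvdr 1?coprime_sym // => /dvdn_leq -/(_ i0); lia.
apply/negP => /eqP h; have : K %| n * i.
  by rewrite (divn_eq (n * i) (2 * K)) h dvdn_add // dvdn_mull // dvdn_mull.
rewrite Gauss_dvdr; first by move=> /dvdn_leq -/(_ i0); lia.
by move: hn; rewrite coprimeMr coprime_sym => /andP[_]; rewrite coprime_sym.
Qed.

Lemma fold_residue_in (K n i : nat) : coprime n (2 * K) ->
  i \in index_iota 1 K -> fold_residue K n i \in index_iota 1 K.
Proof.
move=> hn; rewrite !mem_index_iota => hi.
have /andP[r0 rK] := coprime_residue hn hi; rewrite /fold_residue.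
have : (n * i) %% (2 * K) < 2 * K by rewrite ltn_mod; lia.
by move: r0 rK; set r := _ %% _; clearbody r; case: (ltnP r K); lia.
Qed.

Lemma fold_residue_inj (K n : nat) : coprime n (2 * K) ->
  {in index_iota 1 K &, injective (fold_residue K n)}.
Proof.
move=> hn i j; rewrite !mem_index_iota => hi hj; rewrite /fold_residue.
have K0 : 0 < 2 * K by lia.
have li : (n * i) %% (2 * K) < 2 * K by rewrite ltn_mod.
have lj : (n * j) %% (2 * K) < 2 * K by rewrite ltn_mod.
have Eqm a b : a < 2 * K -> b < 2 * K -> n * a = n * b %[mod 2 * K] -> a = b.
  wlog ab : a b / a <= b => [W|] ha hb hab.
    by case: (leqP a b) => [/W|/ltnW/W h]; [exact|symmetry; exact: h].
  have : 2 * K %| n * (b - a) by rewrite mulnBr -eqn_mod_dvd ?leq_mul //; apply/eqP.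
  rewrite Gauss_dvdr 1?coprime_sym //; case: (posnP (b - a)) => [|h /(dvdn_leq h)]; lia.
have Opp a b : (n * a) %% (2 * K) + (n * b) %% (2 * K) = 2 * K -> 0 < a < K -> 0 < b < K -> False.
  move=> h ha hb; have : 2 * K %| n * (a + b).
    by rewrite mulnDr /dvdn -modnDm h modnn.
  by rewrite Gauss_dvdr 1?coprime_sym // => /dvdn_leq; lia.
case: ltnP => h1; case: ltnP => h2 h.
- by apply: (Eqm) => //; lia.
- by case: (Opp i j) => //; lia.
- by case: (Opp i j) => //; lia.
- by apply: (Eqm); lia.
Qed.

(** Write [b i = 2K t + r]. As [a] is odd, the left floor has the parity of [t] plus the floor of
    [a r / 2K]. If [r = 2K - s] is folded to [s], that floor is [a - 1] minus the floor of
    [a s / 2K], and [a - 1] is even. *)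
Lemma odd_floorM (K a b i : nat) : coprime a (2 * K) -> coprime b (2 * K) -> 0 < i < K ->
  odd ((a * b * i) %/ (2 * K)) =
  odd ((b * i) %/ (2 * K)) (+) odd ((a * fold_residue K b i) %/ (2 * K)).
Proof.
move=> ha hb hi; have K0 : 0 < 2 * K by lia.
have oa : odd a by move: ha; rewrite coprimeMr coprimen2 => /andP[].
have /andP[r0 rK] := coprime_residue hb hi.
rewrite /fold_residue -mulnA {1}(divn_eq (b * i) (2 * K)).
set t := (b * i) %/ (2 * K); set r := (b * i) %% (2 * K) in r0 rK *.
have lr : r < 2 * K by rewrite ltn_mod.
rewrite mulnDr mulnA divnMDl // oddD oddM oa /=; congr (_ (+) _).
case: ltnP => // hr.
have hrr : 0 < 2 * K - r < K by lia.
have /andP[s0 _] := coprime_residue ha hrr.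
set s := 2 * K - r in hrr s0 *; have -> : r = 2 * K - s by lia.
rewrite mulnBr; have ls : (a * s) %% (2 * K) < 2 * K by rewrite ltn_mod.
have e := divn_eq (a * s) (2 * K).
have hq : (a * s) %/ (2 * K) < a by rewrite ltn_divLR //; nia.
rewrite (@divn_unique _ _ (a - 1 - (a * s) %/ (2 * K))).
  by rewrite oddB ?oddB; lia.
by move: e s0 ls hq; set u := _ %/ _; set v := _ %% _ => e *; rewrite e; nia.
Qed.

(** The previous identity is summed over [i]; folding by [b] permutes the range. *)
Lemma floor_parityM (K a b : nat) : coprime a (2 * K) -> coprime b (2 * K) ->
  floor_parity K (a * b) = floor_parity K a (+) floor_parity K b.
Proof.
move=> ha hb; rewrite /floor_parity.
rewrite (eq_big_nat _ _ (fun i hi => odd_floorM ha hb hi)) big_split /= addbC; congr (_ (+) _).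
rewrite -[RHS](perm_big _ (perm_index_iota _ (fold_residue_inj hb))) ?big_map //.
by move=> i; exact: fold_residue_in.
Qed.

Lemma kronM (K a b : nat) : kron K (a * b) = (kron K a * kron K b)%R.
Proof.
rewrite /kron coprimeMl; case: (boolP (coprime a _)) => ha; last by rewrite mul0r.
case: (boolP (coprime b _)) => hb; last by rewrite mulr0.
rewrite /= floor_parityM // -signr_addb; congr (_ ^+ _)%R.
have oa : odd a by move: ha; rewrite coprimeMr coprimen2 => /andP[].
have ob : odd b by move: hb; rewrite coprimeMr coprimen2 => /andP[].
(* On odd numbers, the parity of [n./2] is the nontrivial character mod 4 written additively. *)
have -> : odd (a * b)./2 = odd a./2 (+) odd b./2.
  rewrite -[in LHS](odd_double_half a) -[in LHS](odd_double_half b) oa ob.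
  have -> : (true + a./2.*2) * (true + b./2.*2) = true + (a./2 * b./2.*2 + a./2 + b./2).*2 by lia.
  by rewrite half_bit_double !oddD oddM odd_double andbF.
by case: (odd K); rewrite /= ?addbF // addbACA.
Qed.

(** Adding [4K] to [n] adds [2i] to each floor and [2K] to [n./2], both even. *)
Lemma kron_period (K n : nat) : kron K (n + 4 * K) = kron K n.
Proof.
rewrite /kron; have -> : 4 * K = 2 * (2 * K) by lia.
have -> : coprime (n + 2 * (2 * K)) (2 * K) = coprime n (2 * K).
  by rewrite /coprime addnC gcdnC gcdnMDl gcdnC.
case: (boolP (coprime n _)) => // hn; congr (_ ^+ (_ : bool))%R; congr (_ (+) _).
  rewrite /floor_parity; apply: eq_big_nat => i hi.
  have -> : (n + 2 * (2 * K)) * i = (2 * i) * (2 * K) + n * i by lia.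
  by rewrite divnMDl; [rewrite oddD oddM|lia].
have -> : n + 2 * (2 * K) = n + (2 * K).*2 by lia.
by rewrite halfD odd_double andbF add0n doubleK oddD oddM addbF.
Qed.

Lemma kron_unit (K n : nat) : coprime n (2 * K) -> kron K n = 1%R \/ kron K n = (-1)%R.
Proof. by rewrite /kron => ->; case: (_ (+) _); [right|left]. Qed.

(** * Reciprocity for the symbol, and its value at [8m - 1] *)

Lemma sum_leq_indicator (M q : nat) : q < M -> \sum_(1 <= i < M) (i <= q) = q.
Proof.
case: M => // M; rewrite ltnS; elim: M => [|M IH] in q *.
  by rewrite leqn0 => /eqP->; rewrite big_geq.
rewrite big_nat_recr //= leq_eqVlt => /predU1P[->|]; last first.
  by rewrite ltnS => h; rewrite IH //; move: h; rewrite leqNgt => /negbTE->; rewrite addn0.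
rewrite leqnn addn1; congr _.+1; rewrite -[RHS](IH M) //.
by apply: eq_big_nat => i /andP[_ hi]; rewrite (leq_trans _ (leqnSn M)) // -ltnS hi.
Qed.

(* Eisenstein's count of the lattice points on either side of the diagonal [a j = b i]. *)
Lemma sum_floor_rectangle (x y a b : nat) : coprime a b -> 0 < a -> 0 < b ->
  (forall i, 0 < i < x -> (b * i) %/ a < y) -> (forall j, 0 < j < y -> (a * j) %/ b < x) ->
  y <= b ->
  \sum_(1 <= i < x) (b * i) %/ a + \sum_(1 <= j < y) (a * j) %/ b = x.-1 * y.-1.
Proof.
move=> cab a0 b0 hx hy yb.
rewrite (@eq_big_nat _ _ _ _ _ _ (fun i => \sum_(1 <= j < y) (j * a <= b * i))); last first.
  move=> i hi; rewrite -[LHS](sum_leq_indicator (hx _ hi)).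
  by apply: eq_bigr => j _; rewrite leq_divRL.
rewrite [X in _ + X](@eq_big_nat _ _ _ _ _ _
  (fun j => \sum_(1 <= i < x) (i * b <= a * j))); last first.
  move=> j hj; rewrite -[LHS](sum_leq_indicator (hy _ hj)).
  by apply: eq_bigr => i _; rewrite leq_divRL.
rewrite [X in _ + X]exchange_big -big_split /=.
rewrite (@eq_big_nat _ _ _ _ _ _ (fun _ => y.-1)); first by rewrite sum_nat_const_nat subn1.
move=> i hi; rewrite -big_split /= (@eq_big_nat _ _ _ _ _ _ (fun _ => 1)).
  by rewrite sum_nat_const_nat subn1 muln1.
move=> j hj; rewrite [i * b]mulnC [a * j]mulnC.
(* A point on the diagonal would force [b] to divide [j], although [0 < j < y <= b]. *)
case: (ltngtP (j * a) (b * i)) => // h.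
have : b %| j * a by rewrite h dvdn_mulr.
by rewrite Gauss_dvdl 1?coprime_sym // => /dvdn_leq; lia.
Qed.

(* The representative of [K * j] in [{1, ..., (p-1)/2}] modulo [p] and up to sign. *)
Definition half_rep (K p j : nat) : nat :=
  let r := (2 * K * j) %% p in if odd ((2 * K * j) %/ p) then (p - r)./2 else r./2.

Lemma Fp_nat_inj (p i j : nat) : prime p -> i < p -> j < p -> (i%:R = j%:R :> 'F_p)%R -> i = j.
Proof.
move=> pp hi hj /(congr1 val); rewrite /= !val_Fp_nat // !modn_small //.
Qed.

(** The squares of [1, ..., p./2] are [p./2] distinct roots of [X^(p./2) - 1]; a nonsquare [x] would
    be one root too many. *)
Lemma euler_criterion (p : nat) (x : 'F_p) : prime p -> odd p ->
  (x != 0 -> x ^+ p./2 = 1 -> exists y, y ^+ 2 = x)%R.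
Proof.
move=> pp oddp x0 xh; have p0 := prime_gt0 pp; have p2 : p./2 < p by lia.
have p1 := prime_gt1 pp; have h0 : 0 < p./2 by lia.
have inr j : j \in index_iota 1 p./2.+1 -> 0 < j <= p./2 by rewrite mem_index_iota ltnS.
pose sq := [seq (j%:R ^+ 2)%R : 'F_p | j <- index_iota 1 p./2.+1].
case: (boolP (x \in sq)) => [/mapP[j _ ->]|xsq]; first by exists (j%:R)%R.
have P0 : ('X^(p./2) - 1 != 0 :> {poly 'F_p})%R.
  by rewrite -size_poly_eq0 size_XnsubC.
have := max_poly_roots P0 (rs := x :: sq); rewrite size_XnsubC // /= size_map size_iota subn1 ltnn.
have rootE z : root ('X^(p./2) - 1 : {poly 'F_p})%R z = (z ^+ p./2 == 1)%R.
  by rewrite rootE !hornerE subr_eq0.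
rewrite rootE xh eqxx xsq /= => H; suff : false by [].
apply: H.
  apply/allP => _ /mapP[j /inr hj ->]; rewrite rootE -exprM.
  have -> : 2 * p./2 = p.-1 by lia.
  have j0 : (j%:R != 0 :> 'F_p)%R.
    by rewrite -(dvdn_pcharf (pchar_Fp pp)); apply/negP => /dvdn_leq; lia.
  apply/eqP; apply: (mulIf j0); rewrite mul1r -exprSr prednK //.
  by rewrite -natrX -[in RHS](Fp_nat_mod pp) -(fermat_little j pp) (Fp_nat_mod pp).
rewrite map_inj_in_uniq ?iota_uniq // => i j /inr hi /inr hj /eqP.
rewrite -subr_eq0 subr_sqr mulf_eq0 subr_eq0 => /orP[/eqP|].
  by apply: (Fp_nat_inj pp); lia.
by rewrite -natrD -(dvdn_pcharf (pchar_Fp pp)) => /dvdn_leq; lia.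
Qed.

Section GaussLemma.
Variables (K p : nat).
Hypotheses (pp : prime p) (oddp : odd p) (cKp : coprime K p).

(** Halving [2Kj = t p + r] gives [Kj = (t/2) p + r/2] for even [t], and
    [Kj + (p - r)/2 = ((t + 1)/2) p] for odd [t]. *)
Lemma half_repE (j : nat) : 0 < j <= p./2 ->
  (K%:R * j%:R = (-1) ^+ ((2 * K * j) %/ p) * (half_rep K p j)%:R :> 'F_p)%R /\
  0 < half_rep K p j <= p./2.
Proof.
move=> hj; have p0 := prime_gt0 pp.
have p0F : (p%:R = 0 :> 'F_p)%R by apply/eqP; rewrite -(dvdn_pcharf (pchar_Fp pp)).
have p2 : p./2 < p by lia.
have nr : 0 < (2 * K * j) %% p.
  rewrite lt0n; apply/negP => /eqP h; have : p %| 2 * K * j by rewrite /dvdn h.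
  rewrite Gauss_dvdr; first by move/dvdn_leq; lia.
  by rewrite coprimeMr coprimen2 oddp coprime_sym.
have lr : (2 * K * j) %% p < p by rewrite ltn_mod.
rewrite /half_rep -signr_odd; have := divn_eq (2 * K * j) p.
set t := _ %/ _; set r := _ %% _ in nr lr * => e.
case: (boolP (odd t)) => ot.
  have orr : ~~ odd (p - r) by lia.
  split; last by lia.
  rewrite expr1 mulN1r; apply/eqP; rewrite -subr_eq0 opprK -natrM -natrD.
  rewrite -(dvdn_pcharf (pchar_Fp pp)).
  have -> : K * j + (p - r)./2 = (t./2).+1 * p.
    have et : t * p = (t./2 * p).*2 + p by rewrite doubleMl -mulSnr; congr (_ * _); lia.
    by move: e; rewrite et -(mulnA 2); lia.
  exact: dvdn_mull.
have orr : ~~ odd r by lia.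
split; last by lia.
rewrite expr0 mul1r -natrM.
have -> : K * j = t./2 * p + r./2.
  have et : t * p = (t./2 * p).*2 by rewrite doubleMl; congr (_ * _); lia.
  by move: e; rewrite et -(mulnA 2); lia.
by rewrite natrD natrM p0F mulr0 add0r.
Qed.

(** Gauss's lemma with the count of sign changes replaced by a sum of floors of the same parity, the
    shape that the lattice point count handles. *)
Lemma gauss_lemma : (K%:R ^+ p./2 = (-1) ^+ (\sum_(1 <= j < p./2.+1) (2 * K * j) %/ p) :> 'F_p)%R.
Proof.
have p0 := prime_gt0 pp; have p2 : p./2 < p by lia.
have inr j : j \in index_iota 1 p./2.+1 -> 0 < j <= p./2 by rewrite mem_index_iota ltnS.
have K0 : (K%:R != 0 :> 'F_p)%R.
  rewrite -(dvdn_pcharf (pchar_Fp pp)); move: cKp; rewrite coprime_sym prime_coprime //.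
have P0 : (\prod_(1 <= j < p./2.+1) j%:R != 0 :> 'F_p)%R.
  rewrite prodf_seq_neq0; apply/allP => j /inr hj /=.
  rewrite -(dvdn_pcharf (pchar_Fp pp)); apply/negP => /dvdn_leq; lia.
apply: (mulIf P0).
have -> : (K%:R ^+ p./2 * \prod_(1 <= j < p./2.+1) j%:R =
           \prod_(1 <= j < p./2.+1) (K%:R * j%:R) :> 'F_p)%R.
  by rewrite big_split /= prodr_const_nat subn1.
rewrite (@eq_big_nat _ _ _ _ _ _
  (fun j => (-1) ^+ ((2 * K * j) %/ p) * (half_rep K p j)%:R)%R); last first.
  by move=> j hj; have [] := half_repE hj.
rewrite big_split /=; congr (_ * _)%R.
  by elim/big_rec2: _ => [|j x y _ ->]; rewrite ?expr0 // exprD.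
suff hperm : perm_eq [seq half_rep K p j | j <- index_iota 1 p./2.+1] (index_iota 1 p./2.+1).
  by rewrite -[RHS](perm_big _ hperm) big_map.
apply: perm_index_iota => [j /inr hj|i j /inr hi /inr hj e].
  by rewrite mem_index_iota ltnS; have [] := half_repE hj.
have [ei _] := half_repE hi; have [ej _] := half_repE hj.
have [h|h] : (K%:R * i%:R = K%:R * j%:R :> 'F_p \/ K%:R * i%:R = - (K%:R * j%:R) :> 'F_p)%R.
  rewrite ei ej e -![((-1) ^+ (_ %/ _))%R]signr_odd.
  by case: (odd _); case: (odd _); rewrite ?expr1 ?expr0 ?mulN1r ?mul1r ?opprK; auto.
- by apply: (Fp_nat_inj pp); [lia|lia|apply: (mulfI K0)].
- suff : (p %| i + j) by move/dvdn_leq; lia.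
  rewrite (dvdn_pcharf (pchar_Fp pp)) natrD; apply/eqP; apply: (mulfI K0).
  by rewrite mulr0 mulrDr h addNr.
Qed.

End GaussLemma.

(** The rectangle count for [2K] and [p] turns [floor_parity K p] into the Gauss exponent of [K]
    plus [(K - 1) (p - 1)/2]. With the correction term in [kron] this says that [- K] has Euler
    power 1 mod [p]. *)
Lemma kron_prime (K p : nat) : prime p -> 0 < K -> kron K p = 1%R -> exists b, p %| b ^ 2 + K.
Proof.
move=> pp K0; rewrite /kron; case: (boolP (coprime p _)) => // cp2 /eqP hs.
have [op cpK] : odd p /\ coprime p K.
  by move: cp2; rewrite coprimeMr coprimen2 => /andP[].
have p1 := prime_gt1 pp; have p0 := prime_gt0 pp.
have cKp : coprime K p by rewrite coprime_sym.
have gl := gauss_lemma pp op cKp.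
have rect := @sum_floor_rectangle K p./2.+1 (2 * K) p.
have {}rect : \sum_(1 <= i < K) (p * i) %/ (2 * K) + \sum_(1 <= j < p./2.+1) (2 * K * j) %/ p
    = K.-1 * p./2.
  apply: rect; rewrite 1?coprime_sym //; try lia.
  - by move=> i hi; rewrite ltn_divLR;
      [move: (leq_mul (leqnn p) (ltnW (proj2 (andP hi)))); lia | lia].
  - by move=> j hj; rewrite ltn_divLR //; nia.
have par : odd (\sum_(1 <= i < K) (p * i) %/ (2 * K)) = floor_parity K p.
  rewrite /floor_parity; elim/big_rec2: _ => // i x y _ <-; exact: oddD.
have [y hy] : exists y : 'F_p, (y ^+ 2 = - K%:R)%R.
  apply: (euler_criterion pp op).
    rewrite oppr_eq0 -(dvdn_pcharf (pchar_Fp pp)); move: cpK; rewrite prime_coprime //.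
  rewrite exprNn gl -exprD -signr_odd oddD.
  suff -> : odd p./2 (+) odd (\sum_(1 <= j < p./2.+1) (2 * K * j) %/ p) = false by [].
  have {hs} : floor_parity K p (+) (odd K && odd p./2) = false.
    by move: hs; case: (_ (+) _).
  have := congr1 odd rect; rewrite oddD oddM par.
  have -> : odd K.-1 = ~~ odd K by lia.
  by case: (floor_parity K p); case: (odd K); case: (odd p./2); case: (odd _).
exists (val y); rewrite (dvdn_pcharf (pchar_Fp pp)) natrD natrX natr_Zp hy addNr //.
Qed.

(** The quotient is [4i/3 - i/(6m)]. For [i = 3t] its floor is odd exactly when [t > 0], for
    [i = 3t + 1] exactly when [t <= 2u], and for [i = 3t + 2] never. The odd floors number
    [3u + (2u + 1)], which has the parity of [m]. *)
Lemma floor_parity_base (u : nat) : let m := 3 * u + 1 in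
  floor_parity (3 * m) (8 * m - 1) = odd m.
Proof.
move=> m; have m0 : 0 < m by rewrite /m; lia.
pose F i := odd (((8 * m - 1) * i) %/ (2 * (3 * m))).
have F0 : F 0 = false by rewrite /F muln0 div0n.
(* The vanishing term [i = 0] is added to complete the first block of three. *)
have -> : floor_parity (3 * m) (8 * m - 1) = \big[addb/false]_(0 <= i < 3 * m) F i.
  by rewrite [RHS]big_ltn ?F0 //; lia.
have blocks k : \big[addb/false]_(0 <= i < 3 * k) F i =
    \big[addb/false]_(0 <= t < k) (F (3 * t) (+) F (3 * t + 1) (+) F (3 * t + 2)).
  elim: k => [|k IH]; first by rewrite muln0 !big_geq.
  rewrite mulnS addnC addn3 !big_nat_recr //= -IH !addn1 !addn2 !addbA //.
rewrite blocks (@eq_big_nat _ _ _ _ _ _ (fun t => (0 < t) (+) (t <= 2 * u))); last first.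
  move=> t /andP[_ ht].
  have -> : F (3 * t) = (0 < t).
    case: t ht => [|t] ht; first by rewrite muln0 F0.
    rewrite /F (@divn_unique _ _ (4 * t + 3)); [lia | nia].
  have -> : F (3 * t + 2) = false.
    rewrite /F (@divn_unique _ _ (4 * t + 2)); [lia | rewrite /m; nia].
  rewrite addbF; congr (_ (+) _); rewrite /F; case: leqP => h.
    rewrite (@divn_unique _ _ (4 * t + 1)); [lia | rewrite /m; nia].
  rewrite (@divn_unique _ _ (4 * t)); [lia | rewrite /m; nia].
rewrite big_split /=.
have count k l : \big[addb/false]_(0 <= t < k) (t <= l) = odd (minn k l.+1).
  elim: k => [|k IH]; first by rewrite big_geq // min0n.
  rewrite big_nat_recr //= IH; case: (leqP k l) => h; lia.
have pos k : \big[addb/false]_(0 <= t < k.+1) (0 < t) = odd k.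
  elim: k => [|k IH]; first by rewrite big_nat1.
  by rewrite big_nat_recr //= IH addbT.
rewrite count; have -> : m = (3 * u).+1 by rewrite /m addn1.
rewrite pos; lia.
Qed.

(* [8m - 1] is [-1] mod [4m] and [1] mod [3]. *)
Lemma coprime_base (m : nat) : m %% 3 = 1 -> coprime (8 * m - 1) (2 * (3 * m)).
Proof.
move=> hm.
suff : coprime ((8 * m - 1) * (8 * m - 1)) (2 * (3 * m)) by rewrite coprimeMl andbb.
have -> : (8 * m - 1) * (8 * m - 1) = (8 * (4 * (m %/ 3) + 1)) * (2 * (3 * m)) + 1 by nia.
by rewrite /coprime gcdnC gcdnMDl gcdn1.
Qed.

Lemma kron_base (m : nat) : m %% 3 = 1 -> kron (3 * m) (8 * m - 1) = 1%R.
Proof.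
move=> hm; have em : m = 3 * (m %/ 3) + 1 by lia.
rewrite /kron (coprime_base hm) [in floor_parity _ _]em floor_parity_base -em.
have -> : odd (8 * m - 1)./2 by lia.
have -> : odd (3 * m) = odd m by lia.
by rewrite andbT addbb.
Qed.

(** * Divisor sums of a real character *)

Definition divsum (chi : nat -> int) (n : nat) : int := (\sum_(d <- divisors n) chi d)%R.

Lemma pfactor_ind (P : nat -> Prop) : P 1 ->
  (forall p e r, prime p -> 0 < e -> coprime p r -> 0 < r -> P r -> P (p ^ e * r)) ->
  forall n, 0 < n -> P n.
Proof.
move=> P1 PX; elim/ltn_ind => n IH n0.
case: (ltnP 1 n) => [n1|]; last by move=> n1; have -> : n = 1 by lia.
have pp := pdiv_prime n1; have [r cp e] := pfactor_coprime pp n0.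
have r0 : 0 < r by move: n0; rewrite e muln_gt0 => /andP[].
have l0 : 0 < logn (pdiv n) n by rewrite logn_gt0 mem_primes pp n0 pdiv_dvd.
rewrite e mulnC; apply: PX => //; apply: IH => //.
rewrite e -[X in X < _]muln1 ltn_pmul2l //.
by rewrite -(expn0 (pdiv n)) ltn_exp2l ?prime_gt1.
Qed.

Section DivisorSum.
Variable chi : nat -> int.
Hypotheses (chi1 : chi 1 = 1%R) (chiM : forall a b, chi (a * b) = (chi a * chi b)%R).
Hypothesis chi_val : forall a, [\/ chi a = 0%R, chi a = 1%R | chi a = (-1)%R].

Lemma divsum1 : divsum chi 1 = 1%R.
Proof. by rewrite /divsum big_seq1. Qed.

(** The divisors prime to [p] are those of [r]; the others are [p] times the divisors of [p^e r]. *)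
Lemma divsumX (p e r : nat) : prime p -> coprime p r -> 0 < r ->
  divsum chi (p ^ e.+1 * r) = (divsum chi r + chi p * divsum chi (p ^ e * r))%R.
Proof.
move=> pp cp r0; have p0 := prime_gt0 pp.
have n0 f : 0 < p ^ f * r by rewrite muln_gt0 expn_gt0 p0.
rewrite /divsum mulr_sumr -[X in (_ + X)%R](eq_bigr _ (fun d _ => chiM p d)).
rewrite -(big_map (fun d => p * d) xpredT chi) -big_cat /=.
apply: perm_big; apply: uniq_perm; first exact: divisors_uniq.
  rewrite cat_uniq divisors_uniq map_inj_uniq ?divisors_uniq; last first.
    by move=> a b /eqP; rewrite eqn_pmul2l // => /eqP.
  rewrite andbT /=; apply/hasPn => _ /mapP[d _ ->]; apply/negP.
  rewrite -dvdn_divisors // => h; move: cp; rewrite prime_coprime // => /negP; apply.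
  exact: dvdn_trans (dvdn_mulr d (dvdnn p)) h.
move=> d; rewrite mem_cat -!dvdn_divisors //; apply/idP/orP => [h|[h|/mapP[d' hd ->]]].
- case: (boolP (p %| d)) => [/dvdnP[d' e'] | pd].
    right; apply/mapP; exists d'; last by rewrite e' mulnC.
    by rewrite -dvdn_divisors // -(dvdn_pmul2l p0) mulnA -expnS [p * d']mulnC -e'.
  left; move: h; rewrite Gauss_dvdr // coprimeXr // coprime_sym prime_coprime //.
- by rewrite dvdn_mull.
- by move: hd; rewrite -dvdn_divisors // expnS -mulnA dvdn_pmul2l.
Qed.

(** The local factor is [1 + chi p + ... + (chi p)^e], evaluated for [chi p] equal to 1, 0 and
    -1. *)
Lemma divsum_pfactor (p e r : nat) : prime p -> coprime p r -> 0 < r ->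
  divsum chi (p ^ e * r) =
  (divsum chi r * (if chi p == 1 then e.+1%:R else ((chi p == 0) || ~~ odd e)%:R))%R.
Proof.
move=> pp cp r0; elim: e => [|e IH].
  by rewrite expn0 mul1n /= orbT; case: ifP; rewrite mulr1.
rewrite divsumX // IH; case: (chi_val p) => -> /=.
- by rewrite mul0r addr0 mulr1.
- by rewrite mul1r [in RHS]mulrS mulrDr mulr1.
- case: (odd e) => /=; rewrite ?mulr0 ?mulr1 ?addr0 ?mulN1r ?subrr //.
Qed.

Lemma divsum_ge0 (n : nat) : 0 < n -> (0 <= divsum chi n)%R.
Proof.
move: n; apply: pfactor_ind => [|p e r pp e0 cp r0 IH]; first by rewrite divsum1.
by rewrite divsum_pfactor // mulr_ge0 //; case: ifP.
Qed.

Lemma divsum_sqr_gt0 (n : nat) : 0 < n -> (0 < divsum chi (n ^ 2))%R.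
Proof.
move: n; apply: pfactor_ind => [|p e r pp e0 cp r0 IH]; first by rewrite divsum1.
rewrite expnMn -expnM divsum_pfactor ?coprimeXr // ?expn_gt0 ?r0 //.
by rewrite mulr_gt0 //; case: ifP => // _; rewrite muln2 odd_double orbT.
Qed.

End DivisorSum.

(** * Positive divisor sums of the Jacobi symbol *)

Lemma kron1 (K : nat) : kron K 1 = 1%R.
Proof.
rewrite /kron coprime1n /floor_parity andbF addbF big1_seq // => i.
by rewrite mem_index_iota /= => hi; rewrite mul1n divn_small //; lia.
Qed.

Lemma kron_val (K a : nat) : [\/ kron K a = 0%R, kron K a = 1%R | kron K a = (-1)%R].
Proof.
rewrite /kron; case: ifP => _; last by constructor 1.
by case: (_ (+) _); [constructor 3|constructor 2].
Qed.

(** A positive sum has no vanishing local factor, so primes of odd exponent have symbol 1 and [- K]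
    is a square modulo each of them. Their product is [q], and the Chinese remainder theorem glues
    the square roots. *)
Lemma divsum_kron_gt0 (K n : nat) : 0 < K -> 0 < n -> coprime n (2 * K) ->
  (0 < divsum (kron K) n)%R -> exists q s b, n = q * s ^ 2 /\ q %| b ^ 2 + K.
Proof.
move=> K0; move: n; apply: (@pfactor_ind (fun n => coprime n (2 * K) ->
  (0 < divsum (kron K) n)%R -> exists q s b, n = q * s ^ 2 /\ q %| b ^ 2 + K)).
  by move=> _ _; exists 1, 1, 0.
move=> p e r pp e0 cp r0 IH.
rewrite coprimeMl coprime_pexpl // => /andP[cpK crK].
rewrite (divsum_pfactor (@kronM K) (@kron_val K)) // => hpos.
have hr : (0 < divsum (kron K) r)%R.
  rewrite lt_neqAle (divsum_ge0 (@kron1 K) (@kronM K) (@kron_val K)) ?andbT //.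
  by apply/negP => /eqP h; move: hpos; rewrite -h mul0r ltxx.
have [q [s [b [er hb]]]] := IH crK hr.
case: (boolP (odd e)) => oe; last first.
  exists q, (p ^ e./2 * s), b; split => //.
  have {1}-> : e = e./2 * 2 by lia.
  by rewrite er expnMn expnM; lia.
have chip : kron K p = 1%R.
  move: hpos; rewrite oe orbF; case: (kron_unit cpK) => -> //.
  by rewrite mulr0 ltxx.
have [b' hb'] := kron_prime pp K0 chip.
have cpq : coprime p q by move: cp; rewrite er coprimeMr => /andP[].
exists (p * q), (p ^ e./2 * s), (chinese p q b' b); split.
  have {1}-> : e = (e./2 * 2).+1 by lia.
  by rewrite er expnMn expnS expnM; lia.
have cong d x y : x = y %[mod d] -> d %| y ^ 2 + K -> d %| x ^ 2 + K.
  by move=> h; rewrite /dvdn -(modnDml (x ^ 2)) -modnXm h modnXm modnDml.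
rewrite Gauss_dvd //; apply/andP; split.
  exact: cong (chinese_modl cpq _ _) hb'.
exact: cong (chinese_modr cpq _ _) hb.
Qed.

(** * The hyperbola method *)

Local Open Scope ring_scope.

Section Weights.
Variable R : rcfType.
Implicit Types (f w : nat -> R) (N s t : nat).

(** Whole periods cancel, leaving at most [N] terms. *)
Lemma periodic_partial_sum f N (B : R) s t : (0 < N)%N -> 0 <= B ->
  (forall i, f (i + N)%N = f i) -> \sum_(0 <= i < N) f i = 0 -> (forall i, `|f i| <= B) ->
  `|\sum_(s <= i < t) f i| <= N%:R * B.
Proof.
move=> N0 B0 fN f0 fB.
have win u : \sum_(u <= i < u + N) f i = 0.
  elim: u => // u IH; apply: (addrI (f u)); rewrite addr0.
  rewrite -big_ltn ?ltn_addr // ?addSn ?big_nat_recr ?leq_addr //=.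
  by rewrite IH fN add0r.
have [d dt] := ubnP (t - s); elim: d => // d IH in s dt *.
case: (leqP (t - s) N) => h.
  apply: (le_trans (ler_norm_sum _ _ _)); apply: (@le_trans _ _ (\sum_(s <= i < t) B)).
    by apply: ler_sum.
  by rewrite sumr_const_nat -[X in X <= _]mulr_natl ler_wpM2r // ler_nat.
rewrite (@big_cat_nat _ _ _ (s + N)) /=; [|lia|lia].
by rewrite win add0r; apply: IH; lia.
Qed.

Lemma abel_bound f w (D : R) s t :
  (forall i, (s <= i)%N -> 0 <= w i.+1 <= w i) -> (forall u, `|\sum_(s <= i < u) f i| <= D) ->
  `|\sum_(s <= i < t) f i * w i| <= D * w s.
Proof.
move=> hw hD.
have D0 : 0 <= D by apply: le_trans (hD s); exact: normr_ge0.
have w0 : 0 <= w s by have /andP[h1 h2] := hw s (leqnn s); exact: le_trans h2.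
case: (leqP s t) => st; last by rewrite big_geq ?normr0 ?mulr_ge0 // ltnW.
have abel u : (s <= u)%N -> \sum_(s <= i < u) f i * w i =
    (\sum_(s <= i < u) f i) * w u + \sum_(s <= i < u) (\sum_(s <= j < i.+1) f j) * (w i - w i.+1).
  elim: u => [|u IH]; first by rewrite leqn0 => /eqP->; rewrite !big_geq // mul0r addr0.
  rewrite leq_eqVlt ltnS => /predU1P[->|su]; first by rewrite !big_geq // mul0r addr0.
  by rewrite !(@big_nat_recr _ _ _ u) //= IH //; ring.
rewrite abel //; apply: (le_trans (ler_normD _ _)).
have wt : 0 <= w t.
  move: st; rewrite leq_eqVlt => /predU1P[<- //|].
  by case: t => // t; rewrite ltnS => /hw /andP[].
have -> : D * w s = D * w t + \sum_(s <= i < t) D * (w i - w i.+1).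
  rewrite -mulr_sumr -mulrDr; congr (_ * _); rewrite -(opprK (\sum_(_ <= _ < _) _)) -sumrN.
  rewrite (eq_bigr (fun i => w i.+1 - w i)) ?telescope_sumr //; first by ring.
  by move=> i _; rewrite opprB.
apply: lerD; first by rewrite normrM (ger0_norm wt) ler_wpM2r.
apply: (le_trans (ler_norm_sum _ _ _)); apply: ler_sum_nat => i /andP[si _].
have /andP[_ h] := hw i si.
by rewrite normrM [X in _ * X]ger0_norm ?subr_ge0 // ler_wpM2r ?subr_ge0.
Qed.

(** The weight [n^(-1/2)] is multiplicative and gives the squares a harmonic series, yet decays fast
    enough for the hyperbola tails to stay bounded. It involves only square roots, so the argument
    runs in any real closed field. *)
Definition rsqrt (n : nat) : R := (Num.sqrt n%:R)^-1.

Lemma rsqrt_ge0 n : 0 <= rsqrt n.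
Proof. by rewrite invr_ge0 sqrtr_ge0. Qed.

Lemma rsqrt1 : rsqrt 1 = 1.
Proof. by rewrite /rsqrt sqrtr1 invr1. Qed.

Lemma rsqrtM a b : rsqrt (a * b) = rsqrt a * rsqrt b.
Proof. by rewrite /rsqrt natrM sqrtrM ?ler0n // invfM. Qed.

Lemma rsqrt_anti a b : (0 < a)%N -> (a <= b)%N -> rsqrt b <= rsqrt a.
Proof.
move=> a0 ab; rewrite /rsqrt lef_pV2 ?posrE ?sqrtr_gt0 ?ltr0n //; last exact: leq_trans ab.
by rewrite ler_wsqrtr // ler_nat.
Qed.

Lemma rsqrt_step s i : (0 < s)%N -> (s <= i)%N -> 0 <= rsqrt i.+1 <= rsqrt i.
Proof. by move=> s0 si; rewrite rsqrt_ge0 rsqrt_anti //; lia. Qed.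

Lemma sum_rsqrt y : \sum_(1 <= a < y.+1) rsqrt a <= 2%:R * Num.sqrt y%:R.
Proof.
elim: y => [|y IH]; first by rewrite big_geq // sqrtr0 mulr0.
rewrite big_nat_recr //=; apply: (le_trans (lerD IH (lexx _))); rewrite /rsqrt.
have s0 : 0 < Num.sqrt (y.+1%:R : R) by rewrite sqrtr_gt0 ltr0n.
have es : Num.sqrt (y.+1%:R : R) ^+ 2 = Num.sqrt (y%:R : R) ^+ 2 + 1.
  by rewrite !sqr_sqrtr ?ler0n // -natr1.
move: s0 es; set u := Num.sqrt _; set v := Num.sqrt _ => s0 es.
rewrite -(ler_pM2r s0) mulrDl mulVf ?gt_eqF //.
have := sqr_ge0 (u - v); nra.
Qed.

Section Hyperbola.
Variables (F : nat -> nat -> R) (N : nat).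
Hypotheses (N0 : (0 < N)%N) (F1 : forall a b, `|F a b| <= 1).
Hypotheses (FNl : forall a b, F (a + N)%N b = F a b) (FNr : forall a b, F a (b + N)%N = F a b).
Hypotheses (Fl : forall b, \sum_(0 <= a < N) F a b = 0).
Hypotheses (Fr : forall a, \sum_(0 <= b < N) F a b = 0).

(** Abel summation is applied twice: the inner sum over [b], bounded by [N], is again periodic in
    [a] with zero sum over a period. *)
Lemma square_bound y :
  `|\sum_(1 <= a < y.+1) \sum_(1 <= b < y.+1) F a b * (rsqrt a * rsqrt b)| <= N%:R * N%:R.
Proof.
pose S a := \sum_(1 <= b < y.+1) F a b * rsqrt b.
have SN a : `|S a| <= N%:R.
  have := @abel_bound (F a) rsqrt N%:R 1 y.+1; rewrite rsqrt1 mulr1; apply=> [i|u].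
    exact: rsqrt_step.
  by rewrite -[N%:R]mulr1; apply: periodic_partial_sum.
rewrite (eq_bigr (fun a => S a * rsqrt a)); last first.
  by move=> a _; rewrite /S mulr_suml; apply: eq_bigr => b _; rewrite mulrCA mulrC.
have := @abel_bound S rsqrt (N%:R * N%:R) 1 y.+1; rewrite rsqrt1 mulr1; apply=> [i|u].
  exact: rsqrt_step.
apply: periodic_partial_sum => //.
  by move=> a; apply: eq_bigr => b _; rewrite FNl.
rewrite /S exchange_big big1 //= => b _; by rewrite -mulr_suml Fl mul0r.
Qed.

(** For fixed [a] the sum over [b > y] is at most [N / sqrt (y + 1)] by Abel summation, and the
    weights of [a <= y] add up to at most [2 sqrt y]. *)
Lemma tail_bound y :
  `|\sum_(1 <= a < y.+1) \sum_(y.+1 <= b < (y ^ 2).+1 | (a * b <= y ^ 2)%N)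
     F a b * (rsqrt a * rsqrt b)| <= 2%:R * N%:R.
Proof.
have N1 : (0 : R) <= N%:R by rewrite ler0n.
apply: (le_trans (ler_norm_sum _ _ _)).
apply: (@le_trans _ _ (\sum_(1 <= a < y.+1) rsqrt a * (N%:R * rsqrt y.+1))).
  apply: ler_sum_nat => a /andP[a0 ay].
  rewrite (eq_bigl (fun b => (b < (y ^ 2 %/ a).+1)%N)); last first.
    by move=> b; rewrite ltnS leq_divRL // mulnC.
  rewrite -(@big_nat_widen _ _ _ _ _ _ xpredT); last by rewrite ltnS leq_div.
  rewrite (eq_bigr (fun b => rsqrt a * (F a b * rsqrt b))); last by move=> b _; rewrite mulrCA.
  rewrite -mulr_sumr normrM (ger0_norm (rsqrt_ge0 a)) ler_wpM2l ?rsqrt_ge0 //.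
  apply: abel_bound => [i|u]; first exact: rsqrt_step.
  by rewrite -[N%:R]mulr1; apply: periodic_partial_sum.
rewrite -mulr_suml; apply: (le_trans (ler_wpM2r _ (sum_rsqrt y))).
  by rewrite mulr_ge0 ?rsqrt_ge0.
have h : Num.sqrt y%:R * rsqrt y.+1 <= 1.
  rewrite /rsqrt ler_pdivrMr ?sqrtr_gt0 ?ltr0n // mul1r ler_wsqrtr // ler_nat.
  exact: leqnSn.
have -> : 2%:R * Num.sqrt y%:R * (N%:R * rsqrt y.+1) = 2%:R * N%:R * (Num.sqrt y%:R * rsqrt y.+1).
  by ring.
by rewrite -[X in _ <= X]mulr1 ler_wpM2l // mulr_ge0 ?ler0n.
Qed.

End Hyperbola.

(** Since [a b <= y^2], the factors cannot both exceed [y]: there remain the square and two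
    tails. *)
Lemma hyperbola_split (G : nat -> nat -> R) (y : nat) :
  \sum_(1 <= a < (y ^ 2).+1) \sum_(1 <= b < (y ^ 2).+1 | (a * b <= y ^ 2)%N) G a b =
  \sum_(1 <= a < y.+1) \sum_(1 <= b < y.+1) G a b +
  (\sum_(1 <= a < y.+1) \sum_(y.+1 <= b < (y ^ 2).+1 | (a * b <= y ^ 2)%N) G a b +
   \sum_(1 <= b < y.+1) \sum_(y.+1 <= a < (y ^ 2).+1 | (b * a <= y ^ 2)%N) G a b).
Proof.
have yy : (y <= y ^ 2)%N by case: (posnP y) => [-> //|y0]; rewrite -mulnn leq_pmulr.
rewrite (@big_cat_nat _ _ _ y.+1) //= addrA -big_split /=; congr (_ + _).
  apply: eq_big_nat => a /andP[a0 ay]; rewrite (@big_cat_nat _ _ _ y.+1) //=; congr (_ + _).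
  rewrite big_nat_cond [RHS]big_nat_cond; apply: eq_bigl => b.
  by rewrite andbT andb_idr // => /andP[_ hb]; rewrite -mulnn leq_mul.
rewrite (exchange_big_dep_nat (fun b => (b < y.+1)%N)) /=; last first.
  by move=> a b /andP[ha _] _ _ hab; rewrite ltnNge; apply/negP => hb; move: (leq_mul ha hb); lia.
rewrite -(@big_nat_widen _ _ _ 1 _ _ xpredT) //.
apply: eq_big_nat => b _; apply: eq_bigl => a; by rewrite mulnC.
Qed.

Lemma hyperbola_bound (F : nat -> nat -> R) (N y : nat) : (0 < N)%N ->
  (forall a b, `|F a b| <= 1) ->
  (forall a b, F (a + N)%N b = F a b) -> (forall a b, F a (b + N)%N = F a b) ->
  (forall b, \sum_(0 <= a < N) F a b = 0) -> (forall a, \sum_(0 <= b < N) F a b = 0) ->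
  `|\sum_(1 <= a < (y ^ 2).+1) \sum_(1 <= b < (y ^ 2).+1 | (a * b <= y ^ 2)%N)
     F a b * (rsqrt a * rsqrt b)| <= (N ^ 2 + 4 * N)%:R.
Proof.
move=> N0 F1 FNl FNr Fl Fr; rewrite hyperbola_split.
apply: (le_trans (ler_normD _ _)); rewrite natrD; apply: lerD.
  by rewrite -[(N ^ 2)%N]mulnn natrM; exact: square_bound.
apply: (le_trans (ler_normD _ _)).
have -> : (4 * N)%:R = 2%:R * N%:R + 2%:R * N%:R :> R by rewrite natrM; ring.
apply: lerD; first exact: tail_bound.
under eq_bigr => b _ do under eq_bigr => a _ do rewrite [rsqrt a * _]mulrC.
exact: (@tail_bound (fun b a => F a b) N).
Qed.

Lemma harmonic_lower t : t%:R <= 2%:R * \sum_(0 <= j < 2 ^ t) (j.+1%:R^-1 : R).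
Proof.
elim: t => [|t IH]; first by rewrite big_nat1 invr1; lra.
rewrite expnS mul2n -addnn (@big_cat_nat _ _ _ (2 ^ t)) ?leq_addr //= mulrDr -natr1.
apply: lerD => //;
apply: (@le_trans _ _ (2%:R * \sum_(2 ^ t <= j < 2 ^ t + 2 ^ t) (2 * 2 ^ t)%:R^-1)).
  rewrite sumr_const_nat addnK natrM -[(_^-1) *+ _]mulr_natl.
  have : (2 ^ t)%:R != 0 :> R by rewrite pnatr_eq0 expn_eq0.
  set x := (2 ^ t)%:R => x0; have -> : 2%:R * (x * (2%:R * x)^-1) = 1 by field.
  exact: lexx.
rewrite ler_wpM2l ?ler0n //; apply: ler_sum_nat => j /andP[_ hj].
by rewrite lef_pV2 ?posrE ?ltr0n ?muln_gt0 ?expn_gt0 // ler_nat mul2n -addnn.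
Qed.

Lemma sum_subseq_le (phi : nat -> R) (s r : seq nat) : uniq s -> uniq r ->
  {subset s <= r} -> (forall n, 0 <= phi n) -> \sum_(n <- s) phi n <= \sum_(n <- r) phi n.
Proof.
move=> us ur sr phi0.
have -> : \sum_(n <- s) phi n = \sum_(n <- r | n \in s) phi n.
  rewrite -[RHS]big_filter; apply: perm_big; apply: uniq_perm => //; first exact: filter_uniq.
  by move=> n; rewrite mem_filter andb_idr // => /sr.
by rewrite [X in X <= _]big_mkcond; apply: ler_sum => n _; case: ifP.
Qed.

Lemma sum_divisors_hyperbola (chi phi : nat -> R) (X : nat) :
  \sum_(1 <= n < X.+1) phi n * \sum_(d <- divisors n) chi d =
  \sum_(1 <= a < X.+1) \sum_(1 <= b < X.+1 | (a * b <= X)%N) phi (a * b)%N * chi b.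
Proof.
rewrite (exchange_big_dep_nat xpredT) //=.
have -> : \sum_(1 <= n < X.+1) phi n * \sum_(d <- divisors n) chi d =
  \sum_(1 <= n < X.+1) \sum_(1 <= d < X.+1 | (d %| n)%N) phi n * chi d.
  apply: eq_big_nat => n /andP[n0 nX]; rewrite mulr_sumr -[RHS]big_filter.
  apply: perm_big; apply: uniq_perm; rewrite ?divisors_uniq ?filter_uniq ?iota_uniq //.
  move=> d; rewrite mem_filter mem_index_iota -dvdn_divisors // andb_idr // => h.
  by rewrite (dvdn_gt0 n0 h) ltnS (leq_trans (dvdn_leq n0 h)).
rewrite (exchange_big_dep_nat xpredT) //=.
apply: eq_big_nat => d /andP[d0 dX].
rewrite -[LHS]big_filter -[RHS]big_filter
  -[RHS](big_map (fun a => a * d)%N xpredT (fun n => phi n * chi d)).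
apply: perm_big; apply: uniq_perm; rewrite ?map_inj_uniq ?filter_uniq ?iota_uniq //.
  by move=> a b /eqP; rewrite eqn_pmul2r // => /eqP.
move=> n; rewrite mem_filter mem_index_iota; apply/andP/mapP.
  case=> /dvdnP[a ->] /andP[h1 h2]; exists a => //; rewrite mem_filter mem_index_iota -ltnS h2 /=.
  have a0 : (0 < a)%N by move: h1; rewrite muln_gt0 => /andP[].
  by rewrite a0 (leq_trans _ h2) // ltnS leq_pmulr.
case=> a; rewrite mem_filter mem_index_iota => /andP[h /andP[a0 _]] ->.
by rewrite dvdn_mull // muln_gt0 a0 d0 ltnS.
Qed.

End Weights.

(** * A positive divisor sum in an arithmetic progression *)

Lemma modn_mul_cancel (N g x : nat) : (1 < N)%N -> coprime g N ->
  (g * x == g %[mod N])%N = (x == 1 %[mod N])%N.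
Proof.
move=> N1 gN; case: x => [|x]; last first.
  rewrite eqn_mod_dvd; last by rewrite leq_pmulr.
  rewrite [RHS]eqn_mod_dvd // mulnS addKn subn1 /= Gauss_dvdr // coprime_sym //.
rewrite muln0 mod0n (modn_small N1) eq_sym; apply/negbTE/negP => /eqP h.
have /dvdn_leq : (N %| gcdn g N)%N by rewrite dvdn_gcd dvdnn andbT /dvdn h.
by move/eqP: gN => ->; lia.
Qed.

Lemma big_modn_mul (V : nmodType) (N g : nat) (phi : nat -> V) : coprime g N ->
  \sum_(0 <= b < N) phi ((g * b) %% N)%N = \sum_(0 <= b < N) phi b.
Proof.
move=> gN; rewrite -(big_map (fun b => (g * b) %% N)%N xpredT phi).
apply: perm_big; apply: perm_index_iota => [i|i j]; rewrite !mem_index_iota /=.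
  by move=> h; rewrite ltn_mod; lia.
move=> hi hj; wlog ij : i j hi hj / (i <= j)%N => [W|] h.
  by case: (leqP i j) => [|/ltnW] ij; [apply: W|symmetry; apply: W].
have : (N %| g * (j - i))%N by rewrite mulnBr -eqn_mod_dvd ?leq_mul //; apply/eqP.
rewrite Gauss_dvdr 1?coprime_sym //.
by case: (posnP (j - i)%N) => [|h0 /(dvdn_leq h0)]; lia.
Qed.

Lemma periodic_modn (T : Type) (f : nat -> T) (N : nat) :
  (forall n, f (n + N)%N = f n) -> forall n, f (n %% N)%N = f n.
Proof.
move=> fN n; rewrite [in RHS](divn_eq n N) addnC.
by elim: (n %/ N)%N => [|k IH]; rewrite ?addn0 // mulSn [(N + _)%N]addnC addnA fN.
Qed.

Section ProgressionDivisorSum.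
Variables (chi : nat -> int) (N g : nat).
Hypotheses (N1 : (1 < N)%N) (gN : coprime g N).
Hypotheses (chi1 : chi 1%N = 1) (chiM : forall a b, chi (a * b)%N = chi a * chi b).
Hypothesis chi_val : forall a, [\/ chi a = 0, chi a = 1 | chi a = -1].
Hypotheses (chiN : forall n, chi (n + N)%N = chi n) (chig : chi g = 1).

Let R : rcfType := realalg.
Let h (n : nat) : R := (n == 1 %[mod N])%N%:R - (n == g %[mod N])%N%:R.
Let F (a b : nat) : R := h (a * b)%N * (chi b)%:~R.

(* [F] sums to zero over a period in each variable, so its weighted sum over
   [a b <= y^2] stays bounded; if no [n = g] had a positive divisor sum, the squares
   [(1 + N j)^2] would make it at least a harmonic sum. *)
Lemma exists_divsum_gt0 :
  exists n, [/\ (0 < n)%N, n = g %[mod N] & 0 < divsum chi n].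
Proof.
have hper n : h (n %% N)%N = h n by rewrite /h !modn_mod.
have F1 a b : `|F a b| <= 1.
  rewrite /F /h; case: (_ == _); case: (_ == _); case: (chi_val b) => ->;
  rewrite ?subrr ?subr0 ?sub0r ?mul0r ?mulr0 ?mul1r ?mulN1r ?mulr1z ?mulrN1z
    ?normrN ?normr0 ?normr1 //.
have FNl a b : F (a + N)%N b = F a b.
  have e : ((a + N) * b = b * N + a * b)%N by ring.
  by rewrite /F e -hper modnMDl hper.
have FNr a b : F a (b + N)%N = F a b.
  have e : (a * (b + N) = a * N + a * b)%N by ring.
  by rewrite /F chiN e -hper modnMDl hper.
have chimod b : chi (b %% N)%N = chi b := periodic_modn chiN b.
have Fl b : \sum_(0 <= a < N) F a b = 0.
  (* Replacing [a] by [g a] turns the condition [a b = g] into [a b = 1], so the two indicators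
     cancel. *)
  rewrite /F -mulr_suml /h sumrB -[X in _ - X](big_modn_mul _ gN).
  under [X in _ - X]eq_bigr => a _ do rewrite -modnMml modn_mod modnMml -mulnA modn_mul_cancel //.
  by rewrite subrr mul0r.
have Fr a : \sum_(0 <= b < N) F a b = 0.
  (* The same substitution in [b]; it preserves the character because [chi g = 1]. *)
  rewrite /F /h; under eq_bigr => b _ do rewrite mulrBl.
  rewrite sumrB -[X in _ - X](big_modn_mul _ gN).
  under [X in _ - X]eq_bigr => b _ do
    rewrite modnMmr mulnCA modn_mul_cancel // chimod chiM chig mul1r.
  by rewrite subrr.
(* [t / (2N)] exceeds the hyperbola bound [N^2 + 4N], and [y = N J] is large enough for
   [(1 + N j)^2 <= y^2] whenever [j < J]. *)
pose t := (2 * N * (N ^ 2 + 4 * N)).+1; pose J := (2 ^ t)%N; pose y := (N * J)%N.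
pose P n := (n == g %[mod N])%N && (0 < divsum chi n).
case: (boolP (has P (index_iota 1 (y ^ 2).+1))) => [/hasP[n]|/hasPn noP].
  by rewrite mem_index_iota => /andP[n0 _] /andP[/eqP ng dn]; exists n.
exfalso; pose psi n : R := (n == 1 %[mod N])%N%:R * rsqrt R n * (divsum chi n)%:~R.
have psi0 n : 0 <= psi n.
  case: n => [|n]; first by rewrite /psi /rsqrt sqrtr0 invr0 mulr0 mul0r.
  by rewrite /psi !mulr_ge0 ?ler0n ?rsqrt_ge0 // ler0z divsum_ge0.
pose T := \sum_(1 <= n < (y ^ 2).+1) (h n * rsqrt R n) * \sum_(d <- divisors n) (chi d)%:~R.
have upper : T <= (N ^ 2 + 4 * N)%:R.
  apply: (le_trans (ler_norm _)); rewrite /T sum_divisors_hyperbola.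
  have := @hyperbola_bound R F N y (ltnW N1) F1 FNl FNr Fl Fr.
  congr (`|_| <= _); apply: eq_bigr => a _; apply: eq_bigr => b _.
  by rewrite /F rsqrtM; ring.
(* Under [noP] the divisor sums in the class of [g] are at most 0, so subtracting their terms cannot
   decrease the total. *)
have lower : \sum_(1 <= n < (y ^ 2).+1) psi n <= T.
  apply: ler_sum_nat => n hn; have := noP n; rewrite mem_index_iota => /(_ hn).
  have -> : \sum_(d <- divisors n) (chi d)%:~R = (divsum chi n)%:~R :> R by rewrite raddf_sum.
  rewrite /P /psi /h negb_and -leNgt; case: eqP => [ng|_] /=; last by rewrite subr0.
  rewrite -(ler_int R) => An; rewrite mulrBl mulrBl lerBrDr gerDl mul1r.
  by rewrite mulr_ge0_le0 ?rsqrt_ge0.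
have N0 : (0 < N)%N by exact: ltnW.
have squares : \sum_(0 <= j < J) psi ((1 + N * j) ^ 2)%N <= \sum_(1 <= n < (y ^ 2).+1) psi n.
  rewrite -(big_map (fun j => (1 + N * j) ^ 2)%N xpredT psi); apply: sum_subseq_le => //.
  - rewrite map_inj_uniq ?iota_uniq // => i j /eqP; rewrite eqn_sqr eqn_add2l eqn_pmul2l //.
    by move/eqP.
  - exact: iota_uniq.
  - move=> _ /mapP[j hj ->]; rewrite mem_index_iota expn_gt0 /= ltnS leq_sqr /y.
    move: hj; rewrite mem_index_iota /= => hj.
    by rewrite (leq_trans _ (leq_mul (leqnn N) hj)) // mulnS leq_add2r.
(* The weight of [(1 + N j)^2] is [1 / (1 + N j)], at least [1 / (N (j + 1))]. *)
have harm : (N%:R^-1 : R) * \sum_(0 <= j < J) j.+1%:R^-1 <= \sum_(0 <= j < J) psi ((1 + N * j) ^ 2)%N.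
  rewrite mulr_sumr; apply: ler_sum => j _; rewrite /psi.
  have -> : ((1 + N * j) ^ 2 == 1 %[mod N])%N by rewrite -modnXm addnC mulnC modnMDl modnXm exp1n.
  have A1 : 1 <= (divsum chi ((1 + N * j) ^ 2)%N)%:~R :> R.
    by rewrite -[1](mulr1z 1) ler_int -gtz0_ge1 divsum_sqr_gt0.
  rewrite mul1r; apply: (@le_trans _ _ (rsqrt R ((1 + N * j) ^ 2)%N)); last first.
    by rewrite ler_peMr ?rsqrt_ge0.
  rewrite /rsqrt natrX sqrtr_sqr normr_nat -invfM -natrM lef_pV2 ?posrE ?ltr0n ?muln_gt0 ?N0 //.
  by rewrite ler_nat mulnS leq_add2r.
have := le_trans harm (le_trans squares (le_trans lower upper)).
rewrite mulrC ler_pdivrMr ?ltr0n // -natrM => H.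
have := le_trans (harmonic_lower R t) (ler_wpM2l (ler0n _ 2) H).
rewrite -natrM ler_nat /t; lia.
Qed.

End ProgressionDivisorSum.

(* The ternary representation and the conclusion *)
Local Close Scope ring_scope.

(** Take [n = 8m - 1] mod [12m] with positive divisor sum and split it as [q s^2]; then [q s^2 = -1]
    mod [4m]. *)
Lemma exists_multiplier (m : nat) : (m %% 3 = 1 ->
  exists q s b c, (4 * m %| (q * s ^ 2).+1) /\ q * c = b ^ 2 + 3 * m)%N.
Proof.
move=> hm; have m0 : (0 < m)%N by case: m hm.
have cg := coprime_base hm.
have cgN : coprime (8 * m - 1) (4 * (3 * m)).
  rewrite (_ : 4 * (3 * m) = 2 * (2 * (3 * m)))%N; last by lia.
  by rewrite coprimeMr cg andbT; move: cg; rewrite coprimeMr => /andP[].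
have N1 : (1 < 4 * (3 * m))%N by lia.
have [n [n0 ng dn]] := exists_divsum_gt0 N1 cgN (kron1 _) (@kronM _) (@kron_val _)
  (@kron_period _) (kron_base hm).
have cong d : (d %| 4 * (3 * m) -> n = 8 * m - 1 %[mod d])%N.
  by move=> hd; rewrite -(modn_dvdm n hd) ng modn_dvdm.
have cn : coprime n (2 * (3 * m)).
  rewrite -coprime_modl cong ?coprime_modl // (_ : 4 * (3 * m) = 2 * (2 * (3 * m)))%N.
    exact: dvdn_mull.
  lia.
have K0 : (0 < 3 * m)%N by lia.
have [q [s [b [en /dvdnP[c ec]]]]] := divsum_kron_gt0 K0 n0 cn dn.
exists q, s, b, c; split; last by rewrite mulnC ec.
rewrite -(addn1 (q * s ^ 2)) -en /dvdn -modnDml cong; last by rewrite dvdn_pmul2l // dvdn_mull.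
by rewrite modnDml (_ : 8 * m - 1 + 1 = 2 * (4 * m))%N ?modnMl //; lia.
Qed.

Open Scope Z_scope.

Lemma represented_mod3 (m : Z) : 0 < m -> m mod 3 = 1 -> exists x z w, m = x ^ 2 + hex z w.
Proof.
move=> m0 hm.
have [n en] : exists n, m = Z.of_nat n by exists (Z.to_nat m); rewrite Z2Nat.id //; lia.
have hm' : (n %% 3 = 1)%N.
  by have := Z.div_mod m 3; rewrite hm; set k := m / 3; clearbody k; lia.
have [q [s [b [c [/dvdnP[k hk] hc]]]]] := exists_multiplier hm'.
have hcZ : Z.of_nat q * Z.of_nat c = Z.of_nat b ^ 2 + 3 * m.
  have := f_equal Z.of_nat hc; rewrite -!mulnn; nia.
have hkZ : Z.of_nat q * Z.of_nat s ^ 2 + 1 = Z.of_nat k * (4 * m).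
  move: (f_equal Z.of_nat hk); rewrite -!mulnn; nia.
move: (Z.of_nat q) (Z.of_nat s) (Z.of_nat b) (Z.of_nat c) (Z.of_nat k) (Zle_0_nat q) hcZ hkZ.
move=> {s b c k hk hc} {}q s b c k q0 hc hk.
(* With [l = q s], [l^2 + q = q (q s^2 + 1)] is divisible by [4m], and [- s] inverts [l] mod [4m].
   Doubling [b] turns [3m] into [12m]. *)
apply: (represented_of_congruences m q (q * s) (2 * b) (4 * c)) => //.
- nia.
- lia.
- exists (q * k); transitivity (q * (q * s ^ 2 + 1)); [ring | rewrite hk; ring].
- apply: bezout_rel_prime; apply: (Bezout_intro _ _ _ (- s) k); lia.
Qed.

Theorem theorem5p3 (a b : Z) (ha : 0 < a) (hb : 0 < b) (hab : a <= b) :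
  universal a b <-> (a = 1 /\ b = 2).
Proof.
split; first exact: universal_coefficients.
by case=> -> ->; apply: form12_universal; exact: represented_mod3.
Qed.
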